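(* Let $G$ be a connected finite simple graph and $k$ a positive integer. Then a $k$-restraint $r$ on $G$ belongs to $R_{\max}$'s counterpart $R_{\min}(G,k)$ if and only if $r\simeq r_c^k$, where $r_c^k$ is the constant $k$-restraint $r_c^k(u)=\{1,\dots,k\}$ for all $u\in V(G)$.
   Context: A restraint $r$ on a graph $G$ assigns to each vertex $v$ a finite set $r(v)\subset\mathbb{N}$ of forbidden colours; a proper $x$-colouring $c$ of $G$ is permitted by $r$ if $c(v)\notin r(v)$ for all $v$, and $\pi_r(G,x)$ denotes the number of proper $x$-colourings permitted by $r$. If $G$ has $n$ vertices, a $k$-restraint is a restraint with $|r(v)|=k$ and $r(v)\subseteq\{1,2,\dots,kn\}$ for every vertex $v$. $R_{\min}(G,k)$ is the set of $k$-restraints $r$ on $G$ such that for every $k$-restraint $r'$ on $G$, $\pi_r(G,x)\leq\pi_{r'}(G,x)$ for all sufficiently large $x$. Two restraints $r,r'$ are equivalent, $r\simeq r'$, if there are an automorphism $\phi$ of $G$ and a bijection $f:\bigcup_u r(u)\to\bigcup_u r'(u)$ with $f(r(u))=r'(\phi(u))$ for every vertex $u$. *)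

(* Defs.v *)
From mathcomp Require Import all_boot all_fingroup.
From mathcomp Require Import finmap.

Set Implicit Arguments.
Unset Strict Implicit.
Unset Printing Implicit Defensive.

Local Open Scope fset_scope.

Definition simple_graph (V : finType) (e : rel V) : Prop :=
  symmetric e /\ irreflexive e.

Definition connected_graph (V : finType) (e : rel V) : Prop :=
  forall u v : V, connect e u v.

Definition restraint (V : finType) : Type := V -> {fset nat}.

Definition proper_colouring (V : finType) (e : rel V) (x : nat)
    (c : {ffun V -> 'I_x}) : bool :=
  [forall u, forall v, e u v ==> (c u != c v)].

(* The x colours are 1, ..., x: the ordinal i : 'I_x stands for colour i.+1. *)
Definition permitted (V : finType) (r : restraint V) (x : nat)
    (c : {ffun V -> 'I_x}) : bool :=
  [forall v, (c v).+1 \notin r v].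

(* pi_r(G, x) *)
Definition num_permitted (V : finType) (e : rel V) (r : restraint V)
    (x : nat) : nat :=
  #|[set c : {ffun V -> 'I_x} | proper_colouring e c && permitted r c]|.

Definition k_restraint (V : finType) (k : nat) (r : restraint V) : Prop :=
  forall v : V, #|` r v| = k /\
    (forall i : nat, i \in r v -> 1 <= i <= k * #|V|).

(* Membership in R_min(G, k). *)
Definition Rmin (V : finType) (e : rel V) (k : nat) (r : restraint V) : Prop :=
  k_restraint k r /\
  forall r' : restraint V, k_restraint k r' ->
    exists N : nat, forall x : nat, N <= x ->
      num_permitted e r x <= num_permitted e r' x.

Definition colours (V : finType) (r : restraint V) : {fset nat} :=
  \bigcup_(u <- enum V) r u.

Definition automorphism (V : finType) (e : rel V) (phi : {perm V}) : Prop :=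
  forall u v : V, e (phi u) (phi v) = e u v.

(* The bijection between the two colour sets is a function on nat of which only
   the values on colours r matter. *)
Definition restraint_equiv (V : finType) (e : rel V) (r r' : restraint V)
    : Prop :=
  exists (phi : {perm V}) (f : nat -> nat),
    [/\ automorphism e phi,
        {in colours r &, injective f},
        [fset f i | i in colours r] = colours r'
      & forall u : V, [fset f i | i in r u] = r' (phi u)].

Definition const_restraint (V : finType) (k : nat) : restraint V :=
  fun _ => [fset i in iota 1 k].
Arguments const_restraint V k : clear implicits.

(* Main.v *)
(* Let m(c) be the number of ordered monochromatic edges of a colouring c; it is
   never 1, so 2 [m = 0] + m = 2 + (m - 2) in truncated arithmetic. Summing over
   the permitted colourings gives 2 pi_r(x) up to the remainder
   sum (m - 2). All k-restraints permit (x-k)^n maps, and those monochromatic on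
   uv number (x - |r(u) u r(v)|) (x-k)^(n-2), so an edge with r(u) <> r(v) gains
   at least (x-k)^(n-2) over a constant restraint. The remainders of two
   restraints differ by O(x^(n-3)): a colouring with two monochromatic edges and
   a forbidden colour at some vertex has at most n-3 free values. Hence the
   minimisers are the restraints constant along edges. *)

Require Import Defs.
From mathcomp Require Import all_boot all_fingroup.
From mathcomp Require Import finmap.
From mathcomp Require Import zify.

Set Implicit Arguments.
Unset Strict Implicit.
Unset Printing Implicit Defensive.

(** * Colour sets left over by a forbidden set *)

Definition allowed (x : nat) (s : {fset nat}) : {set 'I_x} :=
  [set j : 'I_x | j.+1 \notin s].

Lemma card_allowed (x : nat) (s : {fset nat}) :
  (forall i, i \in s -> 1 <= i <= x) -> #|allowed x s| = x - #|` s|.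
Proof.
move=> sx; suff <- : #|~: allowed x s| = #|` s|.
  by have := cardsC (allowed x s); rewrite card_ord; lia.
(* Both cardinalities are lengths of duplicate-free lists of naturals with the same members: the
   successors of the ordinals that are not allowed, and the elements of [s]. *)
rewrite cardE -(size_map (fun j : 'I_x => j.+1)) cardfE cardE.
rewrite -(size_map (fun i : s => val i)); apply: perm_size.
apply: uniq_perm.
- by rewrite map_inj_uniq ?enum_uniq // => i j [] /val_inj.
- by rewrite map_inj_uniq ?enum_uniq //; apply: val_inj.
move=> i; apply/mapP/mapP => [[j]|[j _ ->]].
  rewrite mem_enum !inE negbK => js ->.
  by exists [` js]%fset; rewrite // mem_enum.
have := valP j => /= js; have /andP[j0 jx] := sx _ js.
have jx' : (val j).-1 < x by rewrite prednK.
exists (Ordinal jx'); last by rewrite /= prednK.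
by rewrite mem_enum !inE negbK /= prednK.
Qed.

Lemma allowed_inj (x : nat) (s t : {fset nat}) :
  (forall i, i \in s -> 1 <= i <= x) -> (forall i, i \in t -> 1 <= i <= x) ->
  allowed x s = allowed x t -> s = t.
Proof.
move=> sx tx eqA; apply/fsetP => i.
case: (boolP (1 <= i <= x)) => [/andP[i0 ix]|iN].
  have ix' : i.-1 < x by rewrite prednK.
  have /setP/(_ (Ordinal ix')) := eqA.
  by rewrite !inE /= prednK // => /negb_inj.
by rewrite (negPf (contra (sx i) iN)) (negPf (contra (tx i) iN)).
Qed.

(** * Exact counts of permitted and monochromatic maps *)

Section Counting.

Variables (V : finType) (e : rel V).
Hypothesis simpleG : simple_graph e.

Implicit Types (r : restraint V) (k x : nat).

Definition permitted_set r x : {set {ffun V -> 'I_x}} :=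
  [set c | permitted r c].

Definition mono_arcs x (c : {ffun V -> 'I_x}) : nat :=
  #|[set p : V * V | e p.1 p.2 && (c p.1 == c p.2)]|.

Lemma proper_colouringE x (c : {ffun V -> 'I_x}) :
  proper_colouring e c = (mono_arcs c == 0).
Proof.
rewrite /mono_arcs cards_eq0; apply/forallP/eqP => [prop|no u].
  apply/setP => -[u v]; rewrite !inE /=; apply/negP => /andP[euv].
  by apply/negP; have /forallP/(_ v)/implyP := prop u; apply.
apply/forallP => v; apply/implyP => euv; apply/negP => cuv.
by have /setP/(_ (u, v)) := no; rewrite !inE /= euv cuv.
Qed.

(** Reversing a monochromatic arc gives another one, and it is a different arc because there are no
    loops. *)
Lemma mono_arcs_neq1 x (c : {ffun V -> 'I_x}) : mono_arcs c != 1.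
Proof.
have [sym irr] := simpleG.
apply/negP => /cards1P[[u v] /setP eqS].
have := eqS (u, v); rewrite !inE eqxx /= => /andP[euv cuv].
have := eqS (v, u); rewrite !inE /= sym euv eq_sym cuv /= => /esym/eqP[vu _].
by rewrite vu irr in euv.
Qed.

Definition mono_at r x (p : V * V) : {set {ffun V -> 'I_x}} :=
  [set c in permitted_set r x | c p.1 == c p.2].

(* Bonferroni truncated after the linear term, with its exact remainder;
   the factor 2 is there because every edge is counted as two arcs. *)
Lemma num_permitted_arcs r x :
  2 * num_permitted e r x + \sum_(p : V * V | e p.1 p.2) #|mono_at r x p| =
  2 * #|permitted_set r x| + \sum_(c in permitted_set r x) (mono_arcs c - 2).
Proof.
have -> : num_permitted e r x = \sum_(c in permitted_set r x) (mono_arcs c == 0).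
  rewrite /num_permitted -sum1_card big_mkcond [RHS]big_mkcond /=.
  apply: eq_bigr => c _; rewrite !inE proper_colouringE.
  by case: (permitted r c); case: (mono_arcs c == 0).
have -> : \sum_(p : V * V | e p.1 p.2) #|mono_at r x p| =
          \sum_(c in permitted_set r x) mono_arcs c.
  transitivity (\sum_(p : V * V | e p.1 p.2)
                  \sum_(c in permitted_set r x) (c p.1 == c p.2)).
    apply: eq_bigr => p _; rewrite -sum1_card big_mkcond [RHS]big_mkcond /=.
    by apply: eq_bigr => c _; rewrite !inE; case: permitted; case: eqP.
  rewrite exchange_big; apply: eq_bigr => c _.
  rewrite /mono_arcs -sum1_card big_mkcond [RHS]big_mkcond /=.
  by apply: eq_bigr => p _; rewrite !inE; case: e; case: eqP.
rewrite -sum1_card !big_distrr -!big_split /=; apply: eq_bigr => c _.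
by have := mono_arcs_neq1 c; case: (mono_arcs c) => [|[|m]] //; lia.
Qed.

Lemma card_permitted_set r x :
  #|permitted_set r x| = \prod_(v : V) #|allowed x (r v)|.
Proof.
transitivity #|family (fun v => mem (allowed x (r v)))|.
  apply: eq_card => c; rewrite [LHS]inE; apply/forallP/familyP => H v;
    by have := H v; rewrite !inE.
by rewrite card_family foldrE big_map big_enum.
Qed.

Lemma card_mono_at r x (u v : V) : u != v ->
  #|mono_at r x (u, v)| =
  #|allowed x (r u) :&: allowed x (r v)| *
    \prod_(w | (w != u) && (w != v)) #|allowed x (r w)|.
Proof.
move=> uv.
(* Once the common colour [j] of [u] and [v] is fixed, the vertices choose independently: [Fj j w]
   pins [u] and [v] to [j] and leaves the other vertices their allowed colours. *)
pose F (j : 'I_x) w : pred 'I_x :=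
  if (w == u) || (w == v) then pred1 j else predT.
pose Fj j w := [set i in allowed x (r w) | F j w i].
have -> : #|mono_at r x (u, v)| = \sum_(j : 'I_x) #|family (fun w => mem (Fj j w))|.
  rewrite -sum1_card (partition_big (fun c : {ffun V -> 'I_x} => c u) predT) //=.
  apply: eq_bigr => j _; rewrite -sum1_card; apply: eq_bigl => c.
  rewrite [c \in mono_at _ _ _]inE [c \in permitted_set _ _]inE /=.
  apply/idP/familyP.
    move=> /andP[/andP[/forallP pc /eqP cuv] /eqP cj] w.
    rewrite !inE pc /F /=; case: (w =P u) => [->|_] /=; first by rewrite cj.
    by case: (w =P v) => [->|//] /=; rewrite -cuv cj.
  move=> H; have cj : c u = j.
    by have := H u; rewrite !inE /F eqxx /= => /andP[_ /eqP].
  have cjv : c v = j.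
    by have := H v; rewrite !inE /F eqxx orbT /= => /andP[_ /eqP].
  rewrite cj cjv !eqxx !andbT; apply/forallP => w.
  by have := H w; rewrite !inE => /andP[].
rewrite -sum1_card big_distrl [RHS]big_mkcond /=; apply: eq_bigr => j _.
rewrite card_family foldrE big_map big_enum /=.
rewrite (bigD1 u) //= (bigD1 v) /=; last by rewrite eq_sym.
have inFj w i : (i \in Fj j w) = (i \in allowed x (r w)) && F j w i.
  by rewrite inE.
have cF w : (w == u) || (w == v) -> #|Fj j w| = (j \in allowed x (r w)).
  move=> wuv; case: (boolP (j \in _)) => jA.
    apply/eqP/cards1P; exists j; apply/setP => i; rewrite inFj /F wuv !inE.
    by case: eqP => [->|_]; rewrite ?andbF ?andbT //; move: jA; rewrite inE.
  apply/eqP; rewrite cards_eq0; apply/eqP/setP => i; rewrite inE /F wuv !inE.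
  case: eqP => [->|_]; rewrite ?andbF ?andbT //.
  by apply/negbTE; move: jA; rewrite inE.
have E (w : V) : #|[eta mem (Fj j w)]| = #|Fj j w| by apply: eq_card.
rewrite !E !cF ?eqxx ?orbT // [X in _ = if X then _ else _]inE.
case: (j \in _); case: (j \in _) => //=; rewrite !mul1n.
apply: eq_bigr => w /andP[wu wv]; rewrite E; apply: eq_card => i.
by rewrite inFj /F (negPf wu) (negPf wv) /= andbT.
Qed.

(** * Bounding the remainder *)

Lemma card_agree_off x (W : {set V}) (S : {set {ffun V -> 'I_x}}) :
  {in S &, forall c d : {ffun V -> 'I_x}, (forall w, w \notin W -> c w = d w) -> c = d} ->
  #|S| * x ^ #|W| <= x ^ #|V|.
Proof.
move=> det.
have [->|[c0 c0S]] := set_0Vmem S; first by rewrite cards0 mul0n.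
(* For [x = 0] there is no default colour [j0], but then the map [c0] shows that [V] is empty. *)
have [x0|x0] := posnP x.
  have noV (v : V) : False by have := ltn_ord (c0 v); lia.
  have -> : #|V| = 0 by apply: eq_card0 => v; case: (noV v).
  have -> : #|W| = 0 by apply: eq_card0 => v; case: (noV v).
  rewrite !expn0 muln1; apply/card_le1_eqP => c d _ _.
  by apply/ffunP => v; case: (noV v).
pose j0 := Ordinal x0.
(* [res] is injective on [S] by [det], and its image lies among the maps equal to [j0] on [W], of
   which there are [x ^ #|~: W|]. *)
pose res (c : {ffun V -> 'I_x}) := [ffun v => if v \in W then j0 else c v].
rewrite -(card_in_imset (f := res) (D := mem S)); last first.
  move=> c d cS dS /ffunP cd; apply: det => // w wW.
  by have := cd w; rewrite !ffunE (negPf wW).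
have -> : x ^ #|V| = x ^ #|~: W| * x ^ #|W|.
  by rewrite -expnD addnC cardsC.
rewrite leq_mul2r; apply/orP; right.
have -> : x ^ #|~: W| = #|pffun_on j0 (mem (~: W)) (@predT 'I_x)|.
  by rewrite card_pffun_on card_ord.
apply: subset_leq_card; apply/subsetP => _ /imsetP[c _ ->].
apply/pffun_onP; split=> //.
by apply/subsetP => v; rewrite !inE ffunE; case: ifP => //; rewrite eqxx.
Qed.

(** A third arc lies on a second monochromatic edge. Two distinct edges give two independent
    equations: each of [a], [b] copies a vertex outside the pair. The sources [a'] and [b'] may
    coincide. *)
Lemma mono_arcs_gt2 x (c : {ffun V -> 'I_x}) : 2 < mono_arcs c ->
  exists a b a' b', [/\ a != b, (a' != a) && (a' != b), (b' != a) && (b' != b),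
    c a = c a' & c b = c b'].
Proof.
have [sym irr] := simpleG; rewrite /mono_arcs; set M := [set p | _] => M2.
have irrN p : p \in M -> p.1 != p.2.
  by rewrite inE => /andP[ep _]; apply: contraTneq ep => ->; rewrite irr.
have cM p : p \in M -> c p.1 = c p.2 by rewrite inE => /andP[_ /eqP].
have [[u v] pM] : exists p, p \in M by apply/card_gt0P; lia.
have [[u' v'] /setDP[qM]] : exists q, q \in M :\: [set (u, v); (v, u)].
  apply/card_gt0P; have := cardsID [set (u, v); (v, u)] M.
  have : #|M :&: [set (u, v); (v, u)]| <= 2.
    apply: leq_trans (subset_leq_card (subsetIr _ _)) _.
    by rewrite cards2; case: (_ != _).
  lia.
rewrite !inE !xpair_eqE negb_or !negb_and => /andP[N1 N2].
have := irrN _ pM; have := irrN _ qM; have := cM _ pM; have := cM _ qM => /=.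
move=> cq cp u'v' uv.
(* If the edges share an endpoint, it is the source for both others; if they are disjoint, each edge
   has its own source. *)
case: (u' =P u) N1 N2 => [E /= vv' _|/eqP u'u _ /=].
  rewrite E in cq u'v'; exists v, v', u, u.
  by rewrite uv u'v' -cp -cq eq_sym vv'.
case: (u' =P v) => [E /= v'u|/eqP u'v _ /=].
  rewrite E in cq u'v'; exists u, v', v, v.
  by rewrite eq_sym v'u [v == u]eq_sym uv u'v' cp -cq.
case: (v' =P u) => [E|/eqP v'u].
  rewrite E in cq u'v'; exists v, u', u, u.
  by rewrite [v == u']eq_sym u'v uv [u == u']eq_sym u'u -cp cq.
case: (v' =P v) => [E|/eqP v'v].
  exists u, u', v, v; rewrite [u == u']eq_sym u'u [v == u]eq_sym uv.
  by rewrite [v == u']eq_sym u'v cp cq E.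
exists u, u', v, v'; rewrite [u == u']eq_sym u'u [v == u]eq_sym uv.
by rewrite [v == u']eq_sym u'v v'u [v' == u']eq_sym u'v' cp cq.
Qed.

(** Two coincidences and one prescribed colour remove three degrees of freedom, so [card_agree_off]
    applies to a set of three vertices. *)
Lemma card_two_coincidences x (i : nat) (v a b a' b' : V) :
  a != b -> (a' != a) && (a' != b) -> (b' != a) && (b' != b) ->
  #|[set c : {ffun V -> 'I_x} |
      [&& (c v).+1 == i, c a == c a' & c b == c b']]| * x ^ 3 <= x ^ #|V|.
Proof.
move=> ab /andP[a'a a'b] /andP[b'a b'b].
(* [w] is a third vertex whose colour is forced by the colour [i] at [v]. *)
pose w := if v == a then a' else if v == b then b' else v.
have wa : w != a by rewrite /w; case: (eqVneq v a); case: (eqVneq v b).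
have wb : w != b by rewrite /w; case: (eqVneq v a); case: (eqVneq v b).
have -> : 3 = #|w |: [set a; b]|.
  by rewrite cardsU1 cards2 ab !inE (negPf wa) (negPf wb).
apply: card_agree_off => c d; rewrite !inE.
move=> /and3P[/eqP cv /eqP ca /eqP cb] /and3P[/eqP dv /eqP da /eqP db] off.
have cdv : c v = d v by apply: val_inj; apply: succn_inj; rewrite cv dv.
have cdw : c w = d w.
  rewrite /w; case: eqP => [va|_]; first by rewrite -ca -da -va.
  by case: eqP => [vb|//]; rewrite -cb -db -vb.
have offab z : z != a -> z != b -> c z = d z.
  move=> za zb; case: (z =P w) => [->//|/eqP zw]; apply: off.
  by rewrite !inE (negPf zw) (negPf za).
apply/ffunP => z.
case: (z =P a) => [->|/eqP za]; first by rewrite ca da; apply: offab.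
case: (z =P b) => [->|/eqP zb]; first by rewrite cb db; apply: offab.
exact: offab.
Qed.

(** The bound [K] on forbidden colours makes the witnesses range over a finite type [I] that does
    not depend on [x]. A union bound over [I] counts the maps with a nonzero summand, and each
    summand is at most the number of vertex pairs. *)
Lemma sum_not_permitted_bound r K :
  (forall v i, i \in r v -> i < K) ->
  exists C, forall x,
    (\sum_(c in ~: permitted_set r x) (mono_arcs c - 2)) * x ^ 3
      <= C * x ^ #|V|.
Proof.
move=> rK.
pose I : finType := (V * V * V * V * V * 'I_K)%type.
pose good (t : I) := let: (v, a, b, a', b', i) := t in
  [&& a != b, (a' != a) && (a' != b) & (b' != a) && (b' != b)].
exists (#|{: V * V}| * #|{: I}|) => x.
pose T (t : I) := let: (v, a, b, a', b', i) := t in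
  [set c : {ffun V -> 'I_x} |
      [&& (c v).+1 == i, c a == c a' & c b == c b']].
have TB t : good t -> #|T t| * x ^ 3 <= x ^ #|V|.
  case: t => [[[[[v a] b] a'] b'] i] /and3P[ab a'ab b'ab].
  exact: card_two_coincidences.
pose S := \bigcup_(t | good t) T t.
have SB : #|S| * x ^ 3 <= #|{: I}| * x ^ #|V|.
  apply: (@leq_trans ((\sum_(t | good t) #|T t|) * x ^ 3)).
    rewrite leq_mul2r; apply/orP; right; rewrite /S.
    elim/big_rec2: _ => [|t n A _ IH]; first by rewrite cards0.
    by apply: leq_trans (leq_card_setU _ _) _; rewrite leq_add2l.
  rewrite big_distrl /= -sum_nat_const big_mkcond /=.
  by apply: leq_sum => t _; case: ifP => // /TB.
have EB : \sum_(c in ~: permitted_set r x) (mono_arcs c - 2)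
    <= #|{: V * V}| * #|S|.
  rewrite mulnC -sum_nat_const big_mkcond [leqRHS]big_mkcond /=.
  apply: leq_sum => c _; case: ifP => // cN.
  case: (leqP (mono_arcs c) 2) => [|m2]; first by rewrite -subn_eq0 => /eqP->.
  suff -> : c \in S by apply: leq_trans (leq_subr _ _) (max_card _).
  have [a [b [a' [b' [ab a'ab b'ab ca cb]]]]] := mono_arcs_gt2 m2.
  move: cN; rewrite !inE => /forallPn[v]; rewrite negbK => cv.
  apply/bigcupP; exists (v, a, b, a', b', Ordinal (rK _ _ cv)).
    by rewrite /good ab a'ab b'ab.
  by rewrite inE ca cb !eqxx.
apply: leq_trans (leq_mul EB (leqnn _)) _.
by rewrite -!mulnA leq_mul2l SB orbT.
Qed.

(** * Asymptotic comparison of k-restraints *)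

Lemma card_allowed_k k r x (v : V) : k_restraint k r -> k * #|V| <= x ->
  #|allowed x (r v)| = x - k.
Proof.
move=> kr kx; have [rk rV] := kr v; rewrite card_allowed ?rk // => i ir.
by have := rV i ir; lia.
Qed.

Lemma card_mono_at_k k r x (u v : V) : k_restraint k r -> k * #|V| <= x ->
  u != v ->
  #|mono_at r x (u, v)| =
  #|allowed x (r u) :&: allowed x (r v)| * (x - k) ^ (#|V| - 2).
Proof.
move=> kr kx uv; rewrite card_mono_at //; congr (_ * _).
have <- : #|~: [set u; v]| = #|V| - 2.
  by have := cardsC [set u; v]; rewrite cards2 uv; lia.
rewrite -prod_nat_const; apply: eq_big => w; first by rewrite !inE negb_or.
by move=> _; apply: card_allowed_k.
Qed.

(** Compare [num_permitted_arcs] for [r] and [r']: the main terms agree, the arc sum of [r] exceeds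
    that of [r'] by at least [Q], and its remainder exceeds the other by less than [Q]. *)
Lemma num_permitted_lt_of_const k r r' (u v : V) :
  k_restraint k r -> k_restraint k r' -> (forall a b, r a = r b) ->
  e u v -> r' u != r' v ->
  exists N, forall x, N <= x -> num_permitted e r x < num_permitted e r' x.
Proof.
have [_ irr] := simpleG.
move=> kr kr' rc euv ruv.
have neq (q : V * V) : e q.1 q.2 -> q.1 != q.2.
  by move=> eq; apply: contraTneq eq => ->; rewrite irr.
have [C CB] : exists C, forall x,
    (\sum_(c in ~: permitted_set r' x) (mono_arcs c - 2)) * x ^ 3
      <= C * x ^ #|V|.
  apply: (@sum_not_permitted_bound _ (k * #|V|).+1) => w i iw.
  by have [_ /(_ _ iw)] := kr' w; lia.
(* The first term brings all forbidden colours into range, [2 * k] gives [x <= 2 * (x - k)], and the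
   rest gives [C * 2 ^ m < x], which makes the error smaller than [Q]. *)
exists (k * #|V| + 2 * k + C * 2 ^ (#|V| - 2) + 1) => x Nx.
have kx : k * #|V| <= x by lia.
set m := #|V| - 2 in Nx *; pose Q := (x - k) ^ m.
have sum_r : \sum_(q : V * V | e q.1 q.2) #|mono_at r x q| =
             \sum_(q : V * V | e q.1 q.2) (x - k) * Q.
  apply: eq_bigr => -[a b] /neq /= ab; rewrite (card_mono_at_k kr) //.
  by rewrite (rc b a) setIid (card_allowed_k _ kr).
have sum_r' : \sum_(q : V * V | e q.1 q.2) #|mono_at r' x q| + Q <=
              \sum_(q : V * V | e q.1 q.2) (x - k) * Q.
  rewrite (bigD1 (u, v)) //= [leqRHS](bigD1 (u, v)) //= addnAC leq_add //.
    rewrite (card_mono_at_k kr') ?(neq (u, v)) // -/m -/Q addnC -mulSn.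
    (* At the arc [(u, v)] the intersection is a proper subset: otherwise the two allowed sets,
       having equal size, would coincide, and so would [r' u] and [r' v]. *)
    rewrite leq_mul2r; apply/orP; right.
    rewrite -(card_allowed_k u kr' kx); apply: proper_card.
    rewrite properEneq subsetIl andbT; apply: contraNneq ruv => eqI.
    have sub : allowed x (r' u) \subset allowed x (r' v) by apply/setIidPl.
    apply/eqP; apply: (@allowed_inj x).
    + by move=> i iu; have [_ /(_ i iu)] := kr' u; lia.
    + by move=> i iv; have [_ /(_ i iv)] := kr' v; lia.
    apply/eqP; rewrite eqEcard sub.
    by rewrite !(card_allowed_k _ kr' kx) leqnn.
  apply: leq_sum => -[a b] /andP[/neq /= ab _].
  rewrite (card_mono_at_k kr') // leq_mul2r -(card_allowed_k a kr' kx).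
  by rewrite subset_leq_card ?subsetIl ?orbT.
have := num_permitted_arcs r x; have := num_permitted_arcs r' x.
have -> : #|permitted_set r' x| = #|permitted_set r x|.
  rewrite !card_permitted_set; apply: eq_bigr => w _.
  by rewrite (card_allowed_k _ kr) // (card_allowed_k _ kr').
(* Only maps permitted by [r] but not by [r'] can make the remainder of [r] the larger one. *)
have le_all : \sum_(c in permitted_set r x) (mono_arcs c - 2) <=
    \sum_(c in permitted_set r' x) (mono_arcs c - 2) +
    \sum_(c in ~: permitted_set r' x) (mono_arcs c - 2).
  rewrite big_mkcond [X in X + _]big_mkcond [X in _ + X]big_mkcond.
  rewrite -big_split; apply: leq_sum => c _ /=; rewrite [in X in _ + X]inE.
  by case: (c \in _); case: (c \in _); rewrite ?addn0 ?add0n.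
have ltQ : \sum_(c in ~: permitted_set r' x) (mono_arcs c - 2) < Q.
  have x0 : 0 < x by lia.
  rewrite -(ltn_pmul2r (_ : 0 < x ^ 3)) ?expn_gt0 ?x0 //.
  apply: leq_ltn_trans (CB x) _.
  have V2 : 2 <= #|V|.
    have <- : #|[set u; v]| = 2 by rewrite cards2 (neq (u, v)).
    exact: max_card.
  have -> : #|V| = m + 2 by rewrite /m subnK.
  have xm : x ^ m <= 2 ^ m * Q.
    rewrite -expnMn; have [->//|m0] := posnP m.
    by rewrite leq_exp2r //; lia.
  rewrite expnD mulnA; apply: (@leq_ltn_trans (C * (2 ^ m * Q) * x ^ 2)).
    by rewrite leq_mul2r leq_mul2l xm !orbT.
  rewrite [x ^ 3]expnS !mulnA ltn_pmul2r // [Q * x]mulnC.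
  have Q0 : 0 < Q by rewrite expn_gt0; apply/orP; left; lia.
  by rewrite !ltn_pmul2r //; lia.
by rewrite sum_r; lia.
Qed.

(** Renaming colours along a bijection between the two allowed sets preserves properness. *)
Lemma num_permitted_const_le r r' (s s' : {fset nat}) x :
  (forall v, r v = s) -> (forall v, r' v = s') ->
  #|allowed x s| = #|allowed x s'| ->
  num_permitted e r x <= num_permitted e r' x.
Proof.
move=> rs rs' eqA.
(* [g] matches the two enumerations position by position; the default [j] is never reached on
   [allowed x s]. *)
pose g (j : 'I_x) := nth j (enum (allowed x s')) (index j (enum (allowed x s))).
have idx j : j \in allowed x s ->
    index j (enum (allowed x s)) < size (enum (allowed x s')).
  by move=> jA; rewrite -cardE -eqA cardE index_mem mem_enum.
have gA j : j \in allowed x s -> g j \in allowed x s'.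
  by move=> jA; rewrite -mem_enum mem_nth ?idx.
have g_inj : {in allowed x s &, injective g}.
  move=> i j iA jA; rewrite /g (set_nth_default j) ?idx // => /eqP.
  rewrite nth_uniq ?enum_uniq ?idx // => /eqP eqi.
  by rewrite -(nth_index i (_ : i \in enum (allowed x s))) ?mem_enum // eqi
    nth_index ?mem_enum.
pose G (c : {ffun V -> 'I_x}) := [ffun v => g (c v)].
rewrite /num_permitted; set S := [set c | _].
have SA c : c \in S -> forall v, c v \in allowed x s.
  by rewrite inE => /andP[_ /forallP pc] v; have := pc v; rewrite inE rs.
rewrite -(card_in_imset (f := G) (D := mem S)); last first.
  move=> c d cS dS /ffunP cd; apply/ffunP => v; apply: g_inj; try exact: SA.
  by have := cd v; rewrite !ffunE.
apply: subset_leq_card; apply/subsetP => _ /imsetP[c cS ->].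
have cA := SA c cS; move: cS; rewrite !inE => /andP[/forallP prop _].
apply/andP; split.
  apply/forallP => u; apply/forallP => v; apply/implyP => euv.
  have /forallP/(_ v)/implyP/(_ euv) := prop u; rewrite !ffunE.
  by apply: contraNneq => /(g_inj _ _ (cA u) (cA v)) ->.
by apply/forallP => v; have := gA _ (cA v); rewrite rs' ffunE inE.
Qed.

End Counting.

(** * Constant restraints and equivalence *)

Lemma connected_const (V : finType) (e : rel V) (T : eqType) (f : V -> T) :
  connected_graph e -> (forall u v, e u v -> f u = f v) ->
  forall u v, f u = f v.
Proof.
move=> conn fe u v; have /connectP[p ep ->] := conn u v.
elim: p u ep => [|w p IH] u //= /andP[euw ep].
by rewrite (fe _ _ euw); apply: IH.
Qed.

Lemma card_iota_fset k : #|` [fset i in iota 1 k]%fset| = k.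
Proof. by rewrite card_fseq undup_id ?iota_uniq // size_iota. Qed.

Lemma const_restraint_k (V : finType) k : k_restraint k (const_restraint V k).
Proof.
move=> v; rewrite /const_restraint card_iota_fset; split=> // i.
rewrite !inE /= mem_iota add1n ltnS => /andP[-> ik].
by apply: leq_trans ik (leq_pmulr k _); apply/card_gt0P; exists v.
Qed.

Lemma restraint_equiv_const (V : finType) (e : rel V) k (r : restraint V) :
  k_restraint k r ->
  restraint_equiv e r (const_restraint V k) <-> (forall u v, r u = r v).
Proof.
have sub (s : restraint V) u : (s u `<=` colours s)%fset.
  by apply/fsubsetP => i iu; apply/bigfcupP; exists u; rewrite // mem_enum.
move=> kr; split=> [[phi [f [_ f_inj _ fr]]] u v|rc].
  (* Both [r a] and [r b] have image [{1, ..., k}] under [f], which is injective on all colours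
     used. *)
  have incl a b : (r a `<=` r b)%fset.
    apply/fsubsetP => i ia; have : f i \in [fset f j | j in r b]%fset.
      by rewrite fr -[const_restraint _ _ _](fr a); apply/imfsetP; exists i.
    case/imfsetP => j /= jb /f_inj -> //.
      exact: (fsubsetP (sub r a)).
    exact: (fsubsetP (sub r b)).
  by apply/eqP; rewrite eqEfsubset !incl.
exists 1%g.
have [v0 _|noV] := pickP V; last first.
  exists id; split=> [u v|i j _ _||u].
  - by rewrite !permE.
  - by [].
  - rewrite /colours (_ : enum V = [::]); first by rewrite !big_nil imfset0.
    by apply/eqP; rewrite -size_eq0 -cardE; apply/eqP/eq_card0.
  - by have := noV u.
have col (s : restraint V) : (forall u v, s u = s v) -> colours s = s v0.
  move=> sc; apply/eqP; rewrite eqEfsubset sub andbT.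
  by apply/fsubsetP => i /bigfcupP[u _]; rewrite (sc u v0).
have [rk _] := kr v0.
(* Conversely, [f] numbers the colours of the common set [r v0], starting from 1 to land in
   [{1, ..., k}]. *)
pose f i := (index i (enum_fset (r v0))).+1.
have f_inj : {in r v0 &, injective f}.
  by move=> i j iv jv [] eqi; rewrite -(nth_index 0 iv) eqi nth_index.
have im : [fset f i | i in r v0]%fset = const_restraint V k v0.
  apply/eqP; rewrite eqEfcard; apply/andP; split; last first.
    have -> : #|` [fset f i | i in r v0]%fset| = k.
      by rewrite card_in_imfset.
    by rewrite card_iota_fset.
  apply/fsubsetP => _ /imfsetP[i /= iv ->].
  by rewrite !inE /= mem_iota /= -[k]rk ltnS index_mem.
exists f; split=> [u v||| u].
- by rewrite !permE.
- by rewrite col.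
- by rewrite !col.
- by rewrite (rc u v0) im.
Qed.

Theorem theorem3p3 (V : finType) (e : rel V) (k : nat)
    (simpleG : simple_graph e) (connG : connected_graph e) (k_gt0 : 0 < k)
    (r : restraint V) (kr : k_restraint k r) :
  Rmin e k r <-> restraint_equiv e r (const_restraint V k).
Proof.
(* By connectedness, a restraint that is not constant already changes along some edge. *)
have const_or_arc (s : restraint V) :
    (forall u v, s u = s v) \/ exists u v, e u v /\ s u != s v.
  case: (boolP [exists u, exists v, e u v && (s u != s v)]).
    by move=> /existsP[u /existsP[v /andP[euv suv]]]; right; exists u, v.
  move=> /existsPn no; left; apply: connected_const connG _ => u v euv.
  by have /existsPn/(_ v) := no u; rewrite euv /= negbK => /eqP.
rewrite restraint_equiv_const //; split=> [[_ rmin]|rc].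
  have [//|[u [v [euv ruv]]]] := const_or_arc r.
  have [N1 le1] := rmin _ (@const_restraint_k V k).
  have [N2 lt2] := num_permitted_lt_of_const simpleG (@const_restraint_k V k)
    kr (fun _ _ => erefl) euv ruv.
  (* At [N1 + N2] both eventual inequalities hold, and they contradict each other. *)
  by have := le1 (N1 + N2); have := lt2 (N1 + N2); lia.
split=> // r' kr'; have [rc'|[u [v [euv ruv]]]] := const_or_arc r'.
  exists (k * #|V|) => x kx; have [v0 _|noV] := pickP V.
    apply: (@num_permitted_const_le _ _ _ _ (r v0) (r' v0)) => //.
    by rewrite (card_allowed_k v0 kr) // (card_allowed_k v0 kr').
  (* On the empty graph every restraint is vacuously constant, with any value. *)
  by apply: (@num_permitted_const_le _ _ _ _ fset0 fset0) => // v; have := noV v.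
have [N lt] := num_permitted_lt_of_const simpleG kr kr' rc euv ruv.
by exists N => x /lt/ltnW.
Qed.
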